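(* Let $\pi(q)=\frac{(x,y,z)}{1+w}$ denote stereographic projection of unit quaternions $q=w+xi+yj+zk\neq -1$ to $\mathbb{R}^3$. For every $q\in 2I$ with $q\ne\pm1$, the point $\pi(q)$ is a positive multiple of one of the 62 vertices of the M120p, and each of the 62 M120p vertex directions is the direction of $\pi(q)$ for at least one $q\in 2I$. Moreover $|\pi(q)|=\sqrt{(1-w)/(1+w)}$ and $|\pi(q)|\cdot|\pi(-q)|=1$ for all $q\in 2I\setminus\{\pm1\}$, and the 120 elements of $2I$ are distributed as follows. The element $q=+1$ is sent to the origin (Shell 0), the element $q=-1$ corresponds to the point at infinity, and the remaining 118 elements lie on spheres (shells) centred at the origin, each shell containing projections with directions of a single vertex type, with exactly the following radii, types and numbers of elements: Shell 1: radius $1/\sqrt{4\varphi+3}$, Type C, 12 elements (those with $w=\varphi/2$); Shell 2: radius $1/\sqrt3$, Type A, 20 elements ($w=1/2$); Shell 3: radius $5^{1/4}/\varphi^{3/2}$, Type C, 12 elements ($w=1/(2\varphi)$); Shell 4: radius $1$, Type B, 30 elements ($w=0$); Shell 5: radius $\varphi^{3/2}/5^{1/4}$, Type C, 12 elements ($w=-1/(2\varphi)$); Shell 6: radius $\sqrt3$, Type A, 20 elements ($w=-1/2$); Shell 7: radius $\sqrt{4\varphi+3}$, Type C, 12 elements ($w=-\varphi/2$).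
   Context: Let $\varphi=(1+\sqrt5)/2$. Quaternions are written $q=w+xi+yj+zk$, identified with $(w,x,y,z)\in\mathbb{R}^4$. The binary icosahedral group $2I$ (the vertex set of the 600-cell) is the group of 120 unit quaternions consisting of: (a) the 8 elements $\pm1,\pm i,\pm j,\pm k$; (b) the 16 elements $\tfrac12(\pm1\pm i\pm j\pm k)$; (c) the 96 elements whose coordinate vectors $(w,x,y,z)$ are $\tfrac12(0,\pm1,\pm\varphi,\pm\varphi^{-1})$ and all even permutations of these coordinates, with all choices of signs. The M120p has 62 vertices in $\mathbb{R}^3$ of three types (all independent sign choices are allowed): Type A (20 vertices): $(\pm\varphi^2,\pm\varphi^2,\pm\varphi^2)$ and the cyclic permutations of $(\pm\varphi^3,0,\pm\varphi)$. Type C (12 vertices): the cyclic permutations of $(\pm\varphi^3,\pm\varphi^2,0)$. Type B (30 vertices): the cyclic permutations of $(\pm2\varphi^2,0,0)$ and the cyclic permutations of $(\pm\varphi^3,\pm\varphi,\pm\varphi^2)$. The direction of a nonzero vector $u$ is $u/|u|$; a direction has Type A, B or C if it is the direction of an M120p vertex of that type. A shell has a given type if every projected element on it has direction of that type. *)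

(* Defs.v *)
From HB Require Import structures.
From mathcomp Require Import all_boot all_order all_algebra all_fingroup.
From mathcomp Require Import all_classical all_reals all_analysis.

Set Implicit Arguments.
Unset Strict Implicit.
Unset Printing Implicit Defensive.

Import Order.TTheory GRing.Theory Num.Theory.
Import numFieldNormedType.Exports.

Local Open Scope classical_set_scope.
Local Open Scope ring_scope.

Definition golden (R : realType) : R := (1 + Num.sqrt 5) / 2.

(* The library norm of a row vector is the sup norm, so the Euclidean one is
   introduced here. *)
Definition enorm (R : realType) (n : nat) (u : 'rV[R]_n) : R :=
  Num.sqrt (\sum_i u 0 i ^+ 2).

Definition direction (R : realType) (n : nat) (u : 'rV[R]_n) : 'rV[R]_n :=
  (enorm u)^-1 *: u.

Definition sign_changes (R : realType) (n : nat) (u : 'rV[R]_n) :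
    set 'rV[R]_n :=
  [set \row_i ((-1) ^+ e i * u 0 i) | e in [set: 'I_n -> bool]].

(* The sum i + k is taken in 'I_3, that is, modulo 3. *)
Definition cyclic_perms (R : realType) (u : 'rV[R]_3) : set 'rV[R]_3 :=
  [set \row_i u 0 (i + k) | k in [set: 'I_3]].

Definition even_perms (R : realType) (n : nat) (u : 'rV[R]_n) :
    set 'rV[R]_n :=
  [set col_perm s u | s in [set s : 'S_n | ~~ odd_perm s]].

Definition vec3 (R : realType) (x y z : R) : 'rV[R]_3 :=
  \row_(i < 3) [:: x; y; z]`_i.

(* The quaternion w + x i + y j + z k is the vector (w, x, y, z) of R^4. *)
Definition quat (R : realType) (w x y z : R) : 'rV[R]_4 :=
  \row_(i < 4) [:: w; x; y; z]`_i.

Definition quat1 (R : realType) : 'rV[R]_4 := quat 1 0 0 0.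

Definition re_part (R : realType) (q : 'rV[R]_4) : R := q 0 ord0.

Definition vec_part (R : realType) (q : 'rV[R]_4) : 'rV[R]_3 :=
  \row_(i < 3) q 0 (lift ord0 i).

Definition unit_quats (R : realType) : set 'rV[R]_4 := [set q | enorm q = 1].
Arguments unit_quats R : clear implicits.

(* Meaningful for unit quaternions other than -1; at -1 the library convention
   0^-1 = 0 gives an irrelevant value. *)
Definition stereo (R : realType) (q : 'rV[R]_4) : 'rV[R]_3 :=
  (1 + re_part q)^-1 *: vec_part q.

Definition binary_icosahedral (R : realType) : set 'rV[R]_4 :=
  let phi := golden R in
  [set q | exists2 u, u \in [:: quat 1 0 0 0; quat 0 1 0 0;
                                quat 0 0 1 0; quat 0 0 0 1]
                    & q = u \/ q = - u]
  `|` sign_changes (2^-1 *: quat 1 1 1 1)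
  `|` \bigcup_(u in sign_changes (2^-1 *: quat 0 1 phi phi^-1)) even_perms u.
Arguments binary_icosahedral R : clear implicits.

Definition binary_icosahedral_no_pm1 (R : realType) : set 'rV[R]_4 :=
  binary_icosahedral R `\` [set quat1 R; - quat1 R].
Arguments binary_icosahedral_no_pm1 R : clear implicits.

Variant vertex_type := TypeA | TypeB | TypeC.

Definition signed_cyclic (R : realType) (u : 'rV[R]_3) : set 'rV[R]_3 :=
  \bigcup_(v in sign_changes u) cyclic_perms v.

Definition M120p_of_type (R : realType) (T : vertex_type) : set 'rV[R]_3 :=
  let phi := golden R in
  match T with
  | TypeA => sign_changes (vec3 (phi ^+ 2) (phi ^+ 2) (phi ^+ 2))
             `|` signed_cyclic (vec3 (phi ^+ 3) 0 phi)
  | TypeB => signed_cyclic (vec3 (2 * phi ^+ 2) 0 0)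
             `|` signed_cyclic (vec3 (phi ^+ 3) phi (phi ^+ 2))
  | TypeC => signed_cyclic (vec3 (phi ^+ 3) (phi ^+ 2) 0)
  end.
Arguments M120p_of_type R T : clear implicits.

Definition M120p (R : realType) : set 'rV[R]_3 :=
  [set v | exists T, M120p_of_type R T v].
Arguments M120p R : clear implicits.

Definition directions_of_type (R : realType) (T : vertex_type) :
    set 'rV[R]_3 :=
  [set direction v | v in M120p_of_type R T].
Arguments directions_of_type R T : clear implicits.

Definition shell (R : realType) (r : R) : set 'rV[R]_4 :=
  [set q | binary_icosahedral_no_pm1 R q /\ enorm (stereo q) = r].

Definition shell_has_type (R : realType) (r : R) (T : vertex_type) : Prop :=
  forall q, shell r q -> directions_of_type R T (direction (stereo q)).

(* The equivalence says that T is the one and only type of the shell. *)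
Definition shell_description (R : realType)
    (r : R) (T : vertex_type) (n : nat) (w : R) : Prop :=
  [/\ forall T', shell_has_type r T' <-> T' = T,
      (shell r #= `I_n)%card
    & shell r = [set q | binary_icosahedral R q /\ re_part q = w]].

(* Main.v *)
Require Import Defs.
From HB Require Import structures.
From mathcomp Require Import all_boot all_order all_algebra all_fingroup.
From mathcomp Require Import all_classical all_reals all_analysis.
From mathcomp Require Import ring lra.

Set Implicit Arguments.
Unset Strict Implicit.
Unset Printing Implicit Defensive.

Import Order.TTheory GRing.Theory Num.Theory.
Import numFieldNormedType.Exports.

Local Open Scope classical_set_scope.
Local Open Scope ring_scope.

(** All coordinates that occur lie in Z[phi], up to a factor 1/2 for the
quaternions. Since sqrt 5 is irrational, 1 and phi are linearly independent
over Z ([zval_inj]), so an element of Z[phi] is a pair of integers, equality of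
coordinates is decidable, and the group and the 62 vertices become explicit
lists of integer data ([binary_icosahedral_zvecs], [M120p_of_type_zvecs]).

The link between the two lists is [vertex_of]: multiplying the imaginary part
of a doubled quaternion by phi^2, or by phi^3 when the doubled real part is
+-phi, gives exactly a vertex. Both factors are positive, hence pi(q) is a
positive multiple of that vertex ([stereo_vertex]). That vertex_of hits every
vertex, and the type of vertex reached from each real part, is read off the
lists. Two vertices never share a direction: if v' = c v with c > 0 then all
2x2 minors of (v, v') vanish, a polynomial condition over Z[phi] which on the
list of vertices forces v' = v or v' = -v, and the second contradicts c > 0
([vertex_direction_inj]). No sign of an element of Z[phi] has to be computed.

For a unit quaternion |x|^2 = 1 - w^2, so |pi(q)|^2 = (1 - w) / (1 + w)
([stereo_norm2]). This is injective in w on ]-1, 1[, which turns each sphere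
around the origin into a level set of the real part ([shell_layer]), and it
tends to infinity as w tends to -1, which gives the point at infinity
([stereo_cvg_infty]). The seven radii are then identities in Q(phi). *)

(** * Integer models of the group and of the vertices *)

(** Decidable equality of vertex types, which membership in [layers] requires. *)
Definition code_vertex_type (T : vertex_type) : option bool :=
  match T with TypeA => None | TypeB => Some false | TypeC => Some true end.

Definition decode_vertex_type (c : option bool) : vertex_type :=
  match c with None => TypeA | Some false => TypeB | Some true => TypeC end.

Lemma code_vertex_typeK : cancel code_vertex_type decode_vertex_type.
Proof. by case. Qed.

HB.instance Definition _ :=
  Equality.copy vertex_type (can_type code_vertex_typeK).

(** The pair (a, b) stands for a + b phi in Z[phi]. The additive structure is
that of the product; the multiplication, which uses phi^2 = phi + 1, is [gmul]. *)
Definition zphi := (int * int)%type.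

Definition gmul (x y : zphi) : zphi :=
  (x.1 * y.1 + x.2 * y.2, x.1 * y.2 + x.2 * y.1 + x.2 * y.2).

Notation g0 := ((0, 0) : zphi).
Notation g1 := ((1, 0) : zphi).
Notation g2 := ((2, 0) : zphi).
Notation gphi := ((0, 1) : zphi).
Notation gphiV := ((-1, 1) : zphi).
Notation gphi2 := ((1, 1) : zphi).
Notation gphi3 := ((1, 2) : zphi).

Definition signs (l : seq zphi) : seq (seq zphi) :=
  foldr (fun x L => [seq y :: m | y <- [:: x; - x], m <- L]) [:: [::]] l.

Definition swap (x y z : nat) : nat :=
  if z == x then y else if z == y then x else z.

(** Every permutation of {0, 1, 2, 3} is the composite of (2 c), then (1 b), then
(0 a), for unique a, b >= 1 and c >= 2, and its sign is the parity of the number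
of nontrivial factors; the twelve triples kept here enumerate the alternating
group. *)
Definition even_swaps : seq (nat * nat * nat) :=
  [seq t <- [seq (ab, c) | ab <- [seq (a, b) | a <- iota 0 4, b <- iota 1 3],
                           c <- iota 2 2]
  | ~~ ((0 != t.1.1) (+) ((1 != t.1.2) (+) (2 != t.2)))%N].

Definition evens (l : seq zphi) : seq (seq zphi) :=
  [seq mkseq (fun i => l`_(swap 0 t.1.1 (swap 1 t.1.2 (swap 2 t.2 i)))) 4
  | t <- even_swaps].

Definition rots (l : seq zphi) : seq (seq zphi) := [:: l; rot 1 l; rot 2 l].

Definition signed_rots (l : seq zphi) : seq (seq zphi) :=
  undup (flatten [seq rots m | m <- signs l]).

(** Twice the elements of the binary icosahedral group: doubling clears the
denominators. Sign changes of a vector with a zero coordinate come in equal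
pairs, which [undup] merges. *)
Definition icosians : seq (seq zphi) :=
  flatten [seq [:: l; map -%R l] | l <- [:: [:: g2; g0; g0; g0];
    [:: g0; g2; g0; g0]; [:: g0; g0; g2; g0]; [:: g0; g0; g0; g2]]]
  ++ signs [:: g1; g1; g1; g1]
  ++ flatten [seq evens m | m <- undup (signs [:: g0; g1; gphi; gphiV])].

Definition vertices (T : vertex_type) : seq (seq zphi) :=
  match T with
  | TypeA => signs [:: gphi2; gphi2; gphi2]
             ++ signed_rots [:: gphi3; g0; gphi]
  | TypeB => signed_rots [:: (2, 2); g0; g0]
             ++ signed_rots [:: gphi3; gphi; gphi2]
  | TypeC => signed_rots [:: gphi3; gphi2; g0]
  end.

Definition all_vertices := vertices TypeA ++ vertices TypeB ++ vertices TypeC.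

Definition icosians_no_pm1 : seq (seq zphi) :=
  [seq l <- icosians | l \notin [:: [:: g2; g0; g0; g0]; [:: - g2; g0; g0; g0]]].

Lemma mem_icosians_no_pm1 l : (l \in icosians_no_pm1) =
  [&& l != [:: g2; g0; g0; g0], l != [:: - g2; g0; g0; g0] & l \in icosians].
Proof.
by rewrite /icosians_no_pm1 mem_filter andbA; congr (_ && _); rewrite !inE negb_or.
Qed.

(** The argument is the doubled real part of a quaternion. *)
Definition vertex_scale (w : zphi) : zphi :=
  if w \in [:: gphi; - gphi] then gphi3 else gphi2.

Definition vertex_of (l : seq zphi) : seq zphi :=
  map (gmul (vertex_scale l`_0)) (behead l).

(** Doubled real part, vertex type and number of elements of each shell, from
the innermost one outwards. *)
Definition layers : seq (zphi * vertex_type * nat) :=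
  [:: (gphi, TypeC, 12%N); (g1, TypeA, 20%N); (gphiV, TypeC, 12%N);
      (g0, TypeB, 30%N); (- gphiV, TypeC, 12%N); (- g1, TypeA, 20%N);
      (- gphi, TypeC, 12%N)].

(** * Facts decided by enumeration *)

Definition gnorm2 (l : seq zphi) : zphi := foldr (fun x s => gmul x x + s) 0 l.

Lemma uniq_icosians : uniq icosians. Proof. by vm_compute. Qed.

Lemma size_icosians : size icosians = 120%N. Proof. by vm_compute. Qed.

Lemma icosians_size4 : all (fun l => size l == 4) icosians.
Proof. by vm_compute. Qed.

Lemma icosians_norm : all (fun l => gnorm2 l == (4, 0)) icosians.
Proof. by vm_compute. Qed.

Lemma size_icosians_no_pm1 : size icosians_no_pm1 = 118%N. Proof. by vm_compute. Qed.

Lemma uniq_all_vertices : uniq all_vertices. Proof. by vm_compute. Qed.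

Lemma size_all_vertices : size all_vertices = 62%N. Proof. by vm_compute. Qed.

Lemma vertices_size3 : all (fun l => size l == 3) all_vertices.
Proof. by vm_compute. Qed.

Lemma vertices_neq0 : [:: g0; g0; g0] \notin all_vertices.
Proof. by vm_compute. Qed.

(** Collinear vertices are equal or opposite; collinearity is the vanishing of
the three 2x2 minors. *)
Lemma vertices_collinear : all (fun l => all (fun m =>
    all (fun ij => gmul l`_ij.1 m`_ij.2 == gmul l`_ij.2 m`_ij.1)
      [:: (0, 1); (1, 2); (0, 2)]%N ==> (m \in [:: l; map -%R l]))
  all_vertices) all_vertices.
Proof. by vm_compute. Qed.

Lemma icosians_no_pm1_layer :
  all (fun l => l`_0 \in [seq t.1.1 | t <- layers]) icosians_no_pm1.
Proof. by vm_compute. Qed.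

Definition layer (w : zphi) : seq (seq zphi) := [seq l <- icosians | l`_0 == w].

Lemma layers_size : all (fun t => size (layer t.1.1) == t.2) layers.
Proof. by vm_compute. Qed.

Lemma layers_icosians_no_pm1 :
  all (fun t => all (fun l => l \in icosians_no_pm1) (layer t.1.1)) layers.
Proof. by vm_compute. Qed.

Lemma layers_type :
  all (fun t => all (fun l => vertex_of l \in vertices t.1.2) (layer t.1.1)) layers.
Proof. by vm_compute. Qed.

Lemma vertex_of_onto : all (fun v => v \in map vertex_of icosians_no_pm1) all_vertices.
Proof. by vm_compute. Qed.

Lemma layers_inhabited : all (fun t => has predT (layer t.1.1)) layers.
Proof. by vm_compute. Qed.

(** * The golden ratio and the embedding of Z[phi] *)

Section Golden.
Variable R : realType.
Local Notation phi := (golden R).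

Lemma sqrt5_sqr : Num.sqrt 5 ^+ 2 = 5 :> R.
Proof. by rewrite sqr_sqrtr ?ler0n. Qed.

Lemma golden_sqr : phi ^+ 2 = phi + 1.
Proof.
rewrite /golden.
transitivity ((1 + 2 * Num.sqrt 5 + Num.sqrt 5 ^+ 2) / 4 : R); first by field.
by rewrite sqrt5_sqr; field.
Qed.

Lemma golden_gt1 : 1 < phi.
Proof.
have s1 : 1 < Num.sqrt 5 :> R by rewrite -[ltLHS]sqrtr1 ltr_sqrt ?ltr1n ?ltr0n.
by rewrite /golden; lra.
Qed.

Lemma golden_gt0 : 0 < phi. Proof. exact: lt_trans ltr01 golden_gt1. Qed.

Lemma goldenV : phi^-1 = phi - 1.
Proof.
apply: (mulfI (lt0r_neq0 golden_gt0)).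
by rewrite mulfV ?lt0r_neq0 ?golden_gt0//; have := golden_sqr; lra.
Qed.

Lemma golden_cube : phi ^+ 3 = 2 * phi + 1.
Proof. by rewrite exprS golden_sqr; have := golden_sqr; lra. Qed.

(** Irrationality of sqrt 5: the exponent of 5 is even on the left and odd on
the right unless y = 0. *)
Lemma sqr_eq5sqr (x y : int) : x ^+ 2 = 5 * y ^+ 2 -> y = 0.
Proof.
move=> e; apply/eqP; rewrite -absz_eq0; apply/negPn/negP => y0.
have e' : (`|x| ^ 2 = 5 * `|y| ^ 2)%N by rewrite -!abszX e abszM.
have := congr1 (odd \o logn 5) e'; rewrite /= lognX lognM ?lognX; last 2 first.
- by [].
- by rewrite expn_gt0 lt0n y0.
by rewrite oddD !oddM.
Qed.

Definition zval (x : zphi) : R := x.1%:~R + x.2%:~R * phi.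

Lemma zvalD x y : zval (x + y) = zval x + zval y.
Proof. by rewrite /zval /= !rmorphD /=; ring. Qed.

Lemma zvalN x : zval (- x) = - zval x.
Proof. by rewrite /zval /= !rmorphN /=; ring. Qed.

Lemma zvalM x y : zval (gmul x y) = zval x * zval y.
Proof.
rewrite /zval /= !(rmorphD, rmorphM) /=.
transitivity (x.1%:~R * y.1%:~R + (x.1%:~R * y.2%:~R + x.2%:~R * y.1%:~R) * phi
  + x.2%:~R * y.2%:~R * phi ^+ 2 : R); last by ring.
by rewrite golden_sqr; ring.
Qed.

(** If a + b phi = 0 then (2 a + b)^2 = b^2 (2 phi - 1)^2 = 5 b^2, hence b = 0
and a = 0. *)
Lemma zval_inj : injective zval.
Proof.
suff ker x : zval x = 0 -> x = 0.
  move=> x y e; apply/eqP; rewrite -subr_eq0; apply/eqP/ker.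
  by rewrite zvalD zvalN e subrr.
case: x => a b; rewrite /zval /= => e.
have norm0 : (2 * a + b) ^+ 2 = 5 * b ^+ 2.
  apply: (@intr_inj R); rewrite !(rmorphD, rmorphM, rmorphXn) /=.
  have -> : a%:~R = - (b%:~R * phi) :> R by lra.
  transitivity (b%:~R ^+ 2 * (4 * phi ^+ 2 - 4 * phi + 1) : R); first by ring.
  by rewrite golden_sqr; ring.
have b0 := sqr_eq5sqr norm0.
move: e; rewrite b0 mul0r addr0 => /eqP; rewrite intr_eq0 => /eqP ->.
by [].
Qed.

Lemma zval0 : zval g0 = 0. Proof. by rewrite /zval /= mul0r addr0. Qed.
Lemma zval1 : zval g1 = 1. Proof. by rewrite /zval /= mul0r addr0. Qed.
Lemma zval2 : zval g2 = 2. Proof. by rewrite /zval /= mul0r addr0. Qed.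
Lemma zval_phi : zval gphi = phi. Proof. by rewrite /zval /= mul1r add0r. Qed.
Lemma zval_phiV : zval gphiV = phi^-1.
Proof. by rewrite /zval /= goldenV rmorphN /=; ring. Qed.
Lemma zval_phi2 : zval gphi2 = phi ^+ 2.
Proof. by rewrite /zval /= golden_sqr; ring. Qed.
Lemma zval_phi3 : zval gphi3 = phi ^+ 3.
Proof. by rewrite /zval /= golden_cube; ring. Qed.
Lemma zval_2phi2 : zval (2, 2) = 2 * phi ^+ 2.
Proof. by rewrite /zval /= golden_sqr; ring. Qed.

(** * Vectors with coordinates in a multiple of Z[phi] *)

(** The factor h is 1/2 for quaternions and 1 for vertices. *)
Definition zvec (h : R) (n : nat) (l : seq zphi) : 'rV[R]_n :=
  \row_i (h * zval l`_i).

Definition zvecs (h : R) (n : nat) (L : seq (seq zphi)) : set 'rV[R]_n :=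
  [set zvec h n l | l in [set` L]].
Arguments zvecs h n L : clear implicits.

Lemma zvec_inj h n l m : h != 0 -> size l = n -> size m = n ->
  zvec h n l = zvec h n m -> l = m.
Proof.
move=> h0 sl sm /rowP e; apply: (@eq_from_nth _ 0) => [|i]; first by rewrite sl.
rewrite sl => lti; have := e (Ordinal lti); rewrite !mxE /=.
by move/(mulfI h0)/zval_inj.
Qed.

Lemma zvecs_cat h n L M : zvecs h n (L ++ M) = zvecs h n L `|` zvecs h n M.
Proof.
apply/seteqP; split=> [_ [l /= + <-]|_ [] [l /= ml <-]].
- by rewrite mem_cat => /orP[] ml; [left|right]; exists l.
- by exists l; rewrite //= mem_cat ml.
- by exists l; rewrite //= mem_cat ml orbT.
Qed.

Lemma zvecs_flatten h n (f : seq zphi -> seq (seq zphi)) L :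
  zvecs h n (flatten (map f L)) = \bigcup_(l in [set` L]) zvecs h n (f l).
Proof.
apply/seteqP; split=> [_ [m /= /flattenP[_ /mapP[l ml ->] mm] <-]|].
  by exists l => //; exists m.
move=> _ [l /= ml [m /= mm <-]]; exists m => //=.
by apply/flattenP; exists (f l) => //; apply: map_f.
Qed.

Lemma eq_zvecs h n L M : L =i M -> zvecs h n L = zvecs h n M.
Proof. by move=> e; congr (image _ _); apply/seteqP; split=> l /=; rewrite e. Qed.

(** * Sign changes and permutations of coordinates *)

Lemma signsP l m :
  m \in signs l <-> exists e : nat -> bool,
    m = mkseq (fun i => if e i then - l`_i else l`_i) (size l).
Proof.
elim: l m => [|x l IH] m; first by split=> [|[e ->]] //; rewrite inE => /eqP ->; exists xpred0.
rewrite (_ : signs _ = [seq y :: k | y <- [:: x; - x], k <- signs l])//.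
split=> [/allpairsP[[y k] /= [yx kl ->]]|[e ->]].
  have [e ->] := (IH k).1 kl.
  exists (fun i => if i is i'.+1 then e i' else y != x).
  rewrite /mkseq /= (iotaDl 1 0) -map_comp; congr (_ :: _).
  by move: yx; rewrite !inE; case: eqVneq => //= _ /eqP.
apply/allpairsP; exists (if e 0%N then - x else x,
  mkseq (fun i => if e i.+1 then - l`_i else l`_i) (size l)); split=> /=.
- by rewrite !inE; case: (e 0%N); rewrite eqxx ?orbT.
- by apply/IH; exists (fun i => e i.+1).
- by rewrite /mkseq /= (iotaDl 1 0) -map_comp.
Qed.

Lemma size_signs l m : m \in signs l -> size m = size l.
Proof. by case/signsP => e ->; rewrite size_mkseq. Qed.

Lemma sign_changes_zvec h n l : size l = n ->
  sign_changes (zvec h n l) = zvecs h n (signs l).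
Proof.
move=> sl; apply/seteqP; split=> [_ [e _ <-]|_ [m /= /signsP[e ->] <-]].
  exists (mkseq (fun i => if oapp e false (insub i) then - l`_i else l`_i) (size l)).
    by apply/signsP; exists (fun i => oapp e false (insub i)).
  apply/rowP => i; rewrite !mxE nth_mkseq ?sl// valK /= mulr_sign.
  by case: (e i); rewrite ?zvalN ?mulrN.
exists (fun i : 'I_n => e i) => //; apply/rowP => i.
by rewrite !mxE nth_mkseq ?sl// mulr_sign; case: (e i); rewrite ?zvalN ?mulrN.
Qed.

Lemma cyclic_perms_zvec h l : size l = 3 ->
  cyclic_perms (zvec h 3 l) = zvecs h 3 (rots l).
Proof.
case: l => [|x [|y [|z []]]] //= _; apply/seteqP.
have shift k : \row_i zvec h 3 [:: x; y; z] 0 (i + inord k) =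
    zvec h 3 (rot k [:: x; y; z]) \/ (2 < k)%N.
  case: k => [|[|[|k]]]; [left|left|left|by right];
  by apply/rowP => i; case: i => [[|[|[|//]]] ?]; rewrite !mxE /= ?inordK.
split=> [_ [k _ <-]|_ [m /= + <-]].
  have [|] := shift k; rewrite ?inord_val; last by rewrite ltnNge -ltnS ltn_ord.
  move=> ->; exists (rot k [:: x; y; z]) => //=.
  by case: k => [[|[|[|//]]] ?]; rewrite /= !inE eqxx ?orbT.
rewrite /rots !inE => /or3P[] /eqP ->; [exists 0|exists (inord 1)|exists (inord 2)] => //.
- have [|//] := shift 0%N; rewrite rot0 => <-; apply/rowP => i; rewrite !mxE addr0.
  by congr (_ * zval _`_(_ _)); apply/val_inj; rewrite /= inordK.
- by have [|//] := shift 1%N.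
- by have [|//] := shift 2%N.
Qed.

Lemma signed_cyclic_zvec h l : size l = 3 ->
  signed_cyclic (zvec h 3 l) = zvecs h 3 (signed_rots l).
Proof.
move=> sl; rewrite /signed_rots (eq_zvecs _ _ (mem_undup _)).
rewrite zvecs_flatten /signed_cyclic sign_changes_zvec// bigcup_image.
by apply: eq_bigcupr => m /= /size_signs sm; rewrite cyclic_perms_zvec ?sm.
Qed.

Lemma val_tperm n (x y z : 'I_n) : tperm x y z = swap x y z :> nat.
Proof. by rewrite /swap permE /=; rewrite -!val_eqE; case: ifP => // _; case: ifP. Qed.

(** The three transpositions successively bring the images of 0, 1 and 2 back
to 0, 1 and 2; what remains fixes three points, hence the fourth. *)
Lemma perm4_tperm (s : 'S_4) : exists a b c : 'I_4,
  [/\ (1 <= b)%N, (2 <= c)%N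
    & s = (tperm (inord 2) c * (tperm (inord 1) b * tperm ord0 a))%g].
Proof.
pose o1 : 'I_4 := inord 1; pose o2 : 'I_4 := inord 2.
have v1 : o1 = 1%N :> nat by rewrite inordK.
have v2 : o2 = 2%N :> nat by rewrite inordK.
pose s1 := (s * tperm ord0 (s ord0))%g; pose s2 := (s1 * tperm o1 (s1 o1))%g.
pose s3 := (s2 * tperm o2 (s2 o2))%g.
have s10 : s1 ord0 = ord0 by rewrite permM tpermR.
have s11 : s1 o1 != ord0 by rewrite -s10 (inj_eq perm_inj) -val_eqE /= v1.
have s20 : s2 ord0 = ord0 by rewrite permM s10 tpermD// -val_eqE /= v1.
have s21 : s2 o1 = o1 by rewrite permM tpermR.
have s22 : s2 o2 != ord0 by rewrite -s20 (inj_eq perm_inj) -val_eqE /= v2.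
have s22' : s2 o2 != o1 by rewrite -s21 (inj_eq perm_inj) -val_eqE /= v1 v2.
have s30 : s3 ord0 = ord0 by rewrite permM s20 tpermD// -val_eqE /= v2.
have s31 : s3 o1 = o1 by rewrite permM s21 tpermD// -val_eqE /= v1 v2.
have s32 : s3 o2 = o2 by rewrite permM tpermR.
have s3id : s3 = 1%g.
  apply/permP => i; rewrite perm1.
  have [->//|i0] := eqVneq i ord0; have [->//|i1] := eqVneq i o1.
  have [->//|i2] := eqVneq i o2.
  have : [&& s3 i != ord0, s3 i != o1 & s3 i != o2].
    by rewrite -{1}s30 -{1}s31 -{1}s32 !(inj_eq perm_inj) i0 i1 i2.
  move: (s3 i) i0 i1 i2 => j; rewrite -!val_eqE /= v1 v2.
  case: i => [[|[|[|[|k]]]] lti] //= _ _ _.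
  by case: j => [[|[|[|[|k]]]] ltj] //= _; apply/val_inj.
exists (s ord0), (s1 o1), (s2 o2); split.
- by rewrite lt0n.
- move: s22 s22'; rewrite -!val_eqE /= v1.
  by case: (nat_of_ord _) => [|[|]].
- have -> : (tperm o2 (s2 o2) = s2)%g.
    by apply: (mulIg (tperm o2 (s2 o2))); rewrite -/s3 s3id tperm2.
  by rewrite /s2 /s1 -!mulgA (mulgA (tperm o1 _)) tperm2 mul1g tperm2 mulg1.
Qed.

Lemma even_perms_zvec h l : size l = 4 ->
  even_perms (zvec h 4 l) = zvecs h 4 (evens l).
Proof.
move=> sl.
have swapped (a b c : 'I_4) :
    col_perm (tperm (inord 2) c * (tperm (inord 1) b * tperm ord0 a)) (zvec h 4 l)
  = zvec h 4 (mkseq (fun i => l`_(swap 0 a (swap 1 b (swap 2 c i)))) 4).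
  apply/rowP => i; rewrite !mxE nth_mkseq// !permM; congr (_ * zval _`_ _).
  by rewrite !val_tperm !inordK.
have parity (a b c : 'I_4) :
    odd_perm (tperm (inord 2) c * (tperm (inord 1) b * tperm ord0 a))
  = ((0 != a) (+) ((1 != b) (+) (2 != c)))%N.
  rewrite !odd_mul_tperm odd_tperm -!val_eqE /= !inordK//.
  by case: (0 != a)%N; case: (1 != b)%N; case: (2 != c)%N.
apply/seteqP; split=> [_ [s /= + <-]|_ [m /= /mapP[[[a b] c] + ->] <-]].
  have [a [b [c [b1 c2 ->]]]] := perm4_tperm s; rewrite parity swapped => ev.
  exists (mkseq (fun i => l`_(swap 0 a (swap 1 b (swap 2 c i)))) 4) => //=.
  apply/mapP; exists (a : nat, b : nat, c : nat) => //.
  rewrite mem_filter ev; apply: allpairs_f; last by rewrite mem_iota c2 ltn_ord.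
  by apply: allpairs_f; rewrite mem_iota ?b1 ltn_ord.
rewrite mem_filter => /andP[ev] /allpairsP[p [+ + [eab ec]]].
rewrite -{}eab -{}ec => /allpairsP[r [+ + [ea eb]]]; rewrite -{}ea -{}eb.
rewrite !mem_iota => /= a4 /andP[b1 b4] /andP[c2 c4].
exists (tperm (inord 2) (Ordinal c4) * (tperm (inord 1) (Ordinal b4) * tperm ord0 (Ordinal a4)))%g.
  by rewrite /= parity.
by rewrite swapped.
Qed.

(** * The group and the vertices as explicit lists *)

Lemma zvec_opp h n l : size l = n -> zvec h n (map -%R l) = - zvec h n l.
Proof.
move=> sl; apply/rowP => i; rewrite !mxE (nth_map 0) ?sl// zvalN.
by rewrite mulrN.
Qed.

Lemma half_quat w x y z :
  2^-1 *: quat (zval w) (zval x) (zval y) (zval z) = zvec 2^-1 4 [:: w; x; y; z].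
Proof.
apply/rowP => i; rewrite !mxE; congr (_ * _).
by case: i => [[|[|[|[|//]]]] ?].
Qed.

Lemma binary_icosahedral_zvecs : binary_icosahedral R = zvecs 2^-1 4 icosians.
Proof.
rewrite /binary_icosahedral /icosians (zvecs_cat _ _ (flatten _)).
rewrite (zvecs_cat _ _ (signs _)) setUA; congr (_ `|` _ `|` _).
- rewrite zvecs_flatten; set U := [:: [:: g2; g0; g0; g0]; _; _; _].
  have -> : [:: quat 1 0 0 0; quat 0 1 0 0; quat 0 0 1 0; quat 0 0 0 1]
      = [seq zvec 2^-1 4 l | l <- U].
    rewrite /= -!half_quat !(zval0, zval2).
    by congr [:: _; _; _; _]; apply/rowP; case=> [[|[|[|[|//]]]] ?];
      rewrite !mxE /= ?mulr0 ?mulVf.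
  have sU l : l \in U -> size l = 4.
    by rewrite !inE => /or4P[] /eqP ->.
  apply/seteqP; split=> [q [_ /mapP[l lU ->] ql]|_ [l lU] [m ml <-]].
    exists l => //; case: ql => ->; first by exists l; rewrite //= inE eqxx.
    by exists (map -%R l); rewrite ?zvec_opp ?sU//= !inE eqxx orbT.
  exists (zvec 2^-1 4 l); first exact: map_f.
  move: ml; rewrite /= !inE => /orP[] /eqP ->; first by left.
  by right; rewrite zvec_opp ?sU.
- have -> : quat 1 1 1 1 = quat (zval g1) (zval g1) (zval g1) (zval g1).
    by rewrite zval1.
  by rewrite half_quat sign_changes_zvec.
- have -> : quat 0 1 (golden R) (golden R)^-1
      = quat (zval g0) (zval g1) (zval gphi) (zval gphiV).
    by rewrite zval0 zval1 zval_phi zval_phiV.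
  rewrite half_quat zvecs_flatten sign_changes_zvec//.
  rewrite -(eq_zvecs _ _ (mem_undup _)) bigcup_image.
  apply: eq_bigcupr => m mm.
  have /size_signs sm : m \in signs [:: g0; g1; gphi; gphiV] by rewrite -mem_undup.
  by rewrite even_perms_zvec.
Qed.

Lemma vec3_zvec x y z : vec3 (zval x) (zval y) (zval z) = zvec 1 3 [:: x; y; z].
Proof.
by apply/rowP => i; rewrite !mxE mul1r; case: i => [[|[|[|//]]] ?].
Qed.

Lemma M120p_of_type_zvecs T : M120p_of_type R T = zvecs 1 3 (vertices T).
Proof.
rewrite /M120p_of_type -zval_2phi2 -zval_phi3 -zval_phi2 -zval_phi -zval0 !vec3_zvec.
case: T.
- have -> : zvecs 1 3 (vertices TypeA)
      = zvecs 1 3 (signs [:: gphi2; gphi2; gphi2])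
        `|` zvecs 1 3 (signed_rots [:: gphi3; g0; gphi]).
    exact: zvecs_cat.
  congr (_ `|` _); first exact: sign_changes_zvec.
  exact: signed_cyclic_zvec.
- have -> : zvecs 1 3 (vertices TypeB)
      = zvecs 1 3 (signed_rots [:: (2, 2); g0; g0])
        `|` zvecs 1 3 (signed_rots [:: gphi3; gphi; gphi2]).
    exact: zvecs_cat.
  by congr (_ `|` _); exact: signed_cyclic_zvec.
- exact: signed_cyclic_zvec.
Qed.

Lemma M120p_zvecs : M120p R = zvecs 1 3 all_vertices.
Proof.
have cat3 L M N :
    zvecs 1 3 (L ++ M ++ N) = zvecs 1 3 L `|` (zvecs 1 3 M `|` zvecs 1 3 N).
  by rewrite !zvecs_cat.
have -> : zvecs 1 3 all_vertices = zvecs 1 3 (vertices TypeA)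
    `|` (zvecs 1 3 (vertices TypeB) `|` zvecs 1 3 (vertices TypeC)).
  exact: cat3.
transitivity (M120p_of_type R TypeA
    `|` (M120p_of_type R TypeB `|` M120p_of_type R TypeC)); last first.
  by congr (_ `|` (_ `|` _)); exact: M120p_of_type_zvecs.
apply/seteqP; split=> [v [[]]|v]; [by left|by right; left|by right; right|].
by case=> [|[]] vT; [exists TypeA|exists TypeB|exists TypeC].
Qed.

Lemma card_zvecs h n L k : h != 0 -> uniq L -> all (fun l => size l == n) L ->
  size L = k -> (zvecs h n L #= `I_k)%card.
Proof.
move=> h0 uL /allP sL szL.
have -> : zvecs h n L = [set zvec h n (nth [::] L i) | i in `I_k].
  apply/seteqP; split=> [_ [l /= lL <-]|_ [i /= ik <-]].
    exists (index l L); rewrite /= ?nth_index// -szL index_mem//.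
  by exists (nth [::] L i) => //=; rewrite mem_nth ?szL.
apply: inj_card_eq => i j; rewrite !inE /= => ik jk.
move/(zvec_inj h0) => e; apply/eqP; rewrite -(nth_uniq [::] _ _ uL) ?szL//.
by apply/eqP/e; apply/eqP/sL/mem_nth; rewrite szL.
Qed.

End Golden.

Arguments zvecs {R} h n L.

(* From here on the lists enter only through the facts decided above; keeping
   them folded prevents unification from comparing them element by element. *)
Opaque icosians icosians_no_pm1 vertices.

Lemma mem_layer w l : (l \in layer w) = (l`_0 == w) && (l \in icosians).
Proof. exact: mem_filter. Qed.

Lemma icosians_no_pm1_in_layer l :
  l \in icosians_no_pm1 -> exists2 t, t \in layers & l \in layer t.1.1.
Proof.
move=> lN; have /mapP[t tL lt] := allP icosians_no_pm1_layer _ lN; exists t => //.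
by rewrite mem_layer -lt eqxx; move: lN; rewrite mem_icosians_no_pm1 => /and3P[].
Qed.

(** Here the lists are arbitrary, so that the concrete vertices stay folded. *)
Lemma uniq_types_inj (V : eqType) (f : vertex_type -> seq V) :
  uniq (f TypeA ++ f TypeB ++ f TypeC) ->
  forall S T x, x \in f S -> x \in f T -> S = T.
Proof.
rewrite !cat_uniq => /and3P[_ /hasPn disjA /and3P[_ /hasPn disjB _]] S T x.
have AB : x \in f TypeB -> x \notin f TypeA.
  by move=> xB; apply: disjA; rewrite mem_cat xB.
have AC : x \in f TypeC -> x \notin f TypeA.
  by move=> xC; apply: disjA; rewrite mem_cat xC orbT.
have BC : x \in f TypeC -> x \notin f TypeB by exact: disjB.
case: S T => [] [] // xS xT; exfalso.
- exact: (negP (AB xT)).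
- exact: (negP (AC xT)).
- exact: (negP (AB xS)).
- exact: (negP (BC xT)).
- exact: (negP (AC xS)).
- exact: (negP (BC xS)).
Qed.

Lemma mem_types (V : eqType) (f : vertex_type -> seq V) T x :
  x \in f T -> x \in f TypeA ++ f TypeB ++ f TypeC.
Proof. by case: T => xT; rewrite !mem_cat xT ?orbT. Qed.

Lemma mem_vertices T l : l \in vertices T -> l \in all_vertices.
Proof. exact: mem_types. Qed.

Lemma vertices_type_inj S T l :
  l \in vertices S -> l \in vertices T -> S = T.
Proof. exact: (uniq_types_inj uniq_all_vertices). Qed.

Opaque all_vertices layer.

(** * Euclidean norm and directions *)

Section Geometry.
Variable R : realType.

Lemma enorm_ge0 n (u : 'rV[R]_n) : 0 <= enorm u. Proof. exact: sqrtr_ge0. Qed.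

Lemma enorm_eq0 n (u : 'rV[R]_n) : (enorm u == 0) = (u == 0).
Proof.
rewrite sqrtr_eq0; apply/idP/eqP => [le0|->]; last first.
  by rewrite big1// => i _; rewrite mxE expr0n.
have /eqP : \sum_i u 0 i ^+ 2 = 0.
  by apply: le_anti; rewrite le0 sumr_ge0// => i _; exact: sqr_ge0.
rewrite psumr_eq0; last by move=> i _; exact: sqr_ge0.
move=> /allP u0; apply/rowP => i; rewrite mxE.
by have := u0 i (mem_index_enum i); rewrite sqrf_eq0 => /eqP.
Qed.

Lemma enormZ n (c : R) (u : 'rV[R]_n) : 0 <= c -> enorm (c *: u) = c * enorm u.
Proof.
move=> c0; rewrite /enorm.
rewrite (eq_bigr (fun i => c ^+ 2 * u 0 i ^+ 2)); last by move=> i _; rewrite mxE exprMn.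
by rewrite -big_distrr /= sqrtrM ?sqr_ge0// sqrtr_sqr ger0_norm.
Qed.

Lemma directionZ n (c : R) (u : 'rV[R]_n) : 0 < c -> direction (c *: u) = direction u.
Proof.
move=> c0; rewrite /direction enormZ ?ltW// scalerA; congr (_ *: _).
by rewrite invfM mulrC mulrA mulfV ?mul1r// gt_eqF.
Qed.

Lemma direction_eq n (u v : 'rV[R]_n) : u != 0 -> v != 0 ->
  direction u = direction v -> exists2 c, 0 < c & v = c *: u.
Proof.
rewrite -!enorm_eq0 => u0 v0 e; exists (enorm v / enorm u).
  by rewrite divr_gt0// lt_def enorm_ge0 ?u0 ?v0.
by rewrite -scalerA -[_ *: u]/(direction u) e scalerA mulfV// scale1r.
Qed.

(** * Stereographic projection of unit quaternions *)

Lemma re_vec_norm (q : 'rV[R]_4) :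
  \sum_i q 0 i ^+ 2 = re_part q ^+ 2 + \sum_i vec_part q 0 i ^+ 2.
Proof. by rewrite big_ord_recl; congr (_ + _); apply: eq_bigr => i _; rewrite mxE. Qed.

Lemma re_vec_eq (p q : 'rV[R]_4) :
  re_part p = re_part q -> vec_part p = vec_part q -> p = q.
Proof.
move=> ere /rowP evec; apply/rowP => i; have [j ->|->//] := unliftP ord0 i.
by have := evec j; rewrite !mxE.
Qed.

Lemma re_part1 : re_part (quat1 R) = 1. Proof. by rewrite /re_part mxE. Qed.

Lemma vec_part1 : vec_part (quat1 R) = 0.
Proof. by apply/rowP => i; rewrite !mxE; case: i => [[|[|[|//]]] ?]. Qed.

Lemma re_partN (q : 'rV[R]_4) : re_part (- q) = - re_part q.
Proof. by rewrite /re_part mxE. Qed.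

Lemma vec_partN (q : 'rV[R]_4) : vec_part (- q) = - vec_part q.
Proof. by apply/rowP => i; rewrite !mxE. Qed.

Lemma unit_quatE (q : 'rV[R]_4) : unit_quats R q ->
  \sum_i vec_part q 0 i ^+ 2 = 1 - re_part q ^+ 2.
Proof.
rewrite /unit_quats /= => e; have : enorm q ^+ 2 = 1 by rewrite e expr1n.
rewrite sqr_sqrtr; last by rewrite sumr_ge0// => i _; exact: sqr_ge0.
by rewrite re_vec_norm => <-; rewrite addrC addKr.
Qed.

(** If w^2 = 1 the imaginary part of a unit quaternion vanishes, so it is +-1. *)
Lemma unit_re_bounds (q : 'rV[R]_4) : unit_quats R q ->
  q <> quat1 R -> q <> - quat1 R -> -1 < re_part q < 1.
Proof.
move=> /unit_quatE uq q1 qN1.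
have vec0 : re_part q ^+ 2 != 1.
  apply/eqP => re1.
  have v0 : vec_part q = 0.
    apply/eqP; rewrite -enorm_eq0 /enorm uq re1 subrr sqrtr0.
    by [].
  have /orP[] : (re_part q == 1) || (re_part q == -1) by rewrite -sqrf_eq1 re1.
    by move=> /eqP r; apply: q1; apply: re_vec_eq; rewrite ?re_part1 ?vec_part1.
  move=> /eqP r; apply: qN1; apply: re_vec_eq.
    by rewrite re_partN re_part1.
  by rewrite vec_partN vec_part1 oppr0.
have : 0 <= \sum_i vec_part q 0 i ^+ 2 by rewrite sumr_ge0// => i _; exact: sqr_ge0.
rewrite uq subr_ge0 => le1; have : re_part q ^+ 2 < 1 by rewrite lt_neqAle vec0.
by move=> lt1; apply/andP; split; nra.
Qed.

Definition shell_radius (w : R) : R := Num.sqrt ((1 - w) / (1 + w)).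

(** |x|^2 / (1 + w)^2 = (1 - w^2) / (1 + w)^2. *)
Lemma stereo_norm2 (q : 'rV[R]_4) : unit_quats R q -> -1 < re_part q ->
  \sum_i stereo q 0 i ^+ 2 = (1 - re_part q) / (1 + re_part q).
Proof.
move=> uq reN1; have re0 : 1 + re_part q != 0 by rewrite gt_eqF//; lra.
transitivity ((1 + re_part q) ^- 2 * \sum_i vec_part q 0 i ^+ 2).
  by rewrite big_distrr; apply: eq_bigr => i _; rewrite mxE exprMn exprVn.
by rewrite unit_quatE//; field.
Qed.

Lemma enorm_stereo (q : 'rV[R]_4) : unit_quats R q -> -1 < re_part q ->
  enorm (stereo q) = shell_radius (re_part q).
Proof. by move=> uq reN1; rewrite /enorm stereo_norm2. Qed.

Lemma shell_radiusN (w : R) : -1 < w < 1 -> shell_radius (- w) = (shell_radius w)^-1.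
Proof.
move=> /andP[w1 w2]; rewrite /shell_radius -sqrtrV; last by rewrite divr_ge0//; lra.
by rewrite invfM invrK opprK mulrC.
Qed.

Lemma shell_radius_gt0 (w : R) : -1 < w < 1 -> 0 < shell_radius w.
Proof. by move=> /andP[w1 w2]; rewrite sqrtr_gt0 divr_gt0//; lra. Qed.

Lemma shell_radius_inj (v w : R) : -1 < v < 1 -> -1 < w < 1 ->
  shell_radius v = shell_radius w -> v = w.
Proof.
move=> /andP[v1 v2] /andP[w1 w2] e.
have : shell_radius v ^+ 2 = shell_radius w ^+ 2 by rewrite e.
rewrite !sqr_sqrtr ?divr_ge0; try lra.
have v0 : 1 + v != 0 by rewrite gt_eqF//; lra.
have w0 : 1 + w != 0 by rewrite gt_eqF//; lra.
by move/eqP; rewrite eqr_div// => /eqP; lra.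
Qed.

(** A compact K has squared coordinates bounded by some N, so if pi(q) is in K
then (1 - w) / (1 + w) <= 3 N, that is 2 <= (3 N + 1) (1 + w); this fails as
soon as 1 + w < 1 / (3 N + 1), hence on a neighbourhood of -1. *)
Lemma stereo_cvg_infty :
  (Some (stereo q) : one_point_compactification 'rV[R]_3)
    @[q --> within (unit_quats R) ((- quat1 R)^')]
  --> (None : one_point_compactification 'rV[R]_3).
Proof.
move=> U [K [cK _] KU] /=.
have [N N0 KN] : exists2 N : R, 0 < N & forall u, K u -> forall i, u 0 i ^+ 2 <= N.
  have /pinfty_ex_gt0[M M0 KM] := compact_bounded cK.
  exists ((M + 1) ^+ 2) => [|u /KM /= uM i]; first by rewrite exprn_gt0//; lra.
  have : ball (0 : 'rV[R]_3) (M + 1) u by rewrite mx_norm_ball /ball_ /= sub0r normrN; lra.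
  move=> [_ /(_ 0 i)]; rewrite /ball /= mxE sub0r normrN => ltM.
  by rewrite -[leLHS]real_normK ?num_real// lerXn2r// ?nnegrE; lra.
pose e := (3 * N + 1)^-1; have e0 : 0 < e by rewrite invr_gt0; lra.
suff : \forall q \near (- quat1 R)^', unit_quats R q -> U (Some (stereo q)) by [].
near=> q => uq.
apply: KU; left; exists (stereo q) => // Kq.
have qN1 : q <> - quat1 R.
  by apply/eqP; near: q; exact: nbhs_dnbhs_neq.
have reN1 : -1 < re_part q.
  have [->|q1] := eqVneq q (quat1 R); first by rewrite re_part1; lra.
  by have /andP[] := unit_re_bounds uq (elimN eqP q1) qN1.
have : re_part q + 1 < e.
  have : ball (- quat1 R) e q by near: q; apply: nbhs_dnbhs; exact: nbhsx_ballx.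
  move=> [_ /(_ 0 ord0)]; rewrite /ball /= -/(re_part q) -/(re_part (- quat1 R)).
  rewrite re_partN re_part1 => /ltr_normlP[]; lra.
apply/negP; rewrite -leNgt.
have : \sum_i stereo q 0 i ^+ 2 <= 3 * N.
  rewrite (_ : 3 * N = \sum_(i < 3) N); last by rewrite sumr_const card_ord mulr_natl.
  by apply: ler_sum => i _; exact: KN.
rewrite stereo_norm2// ler_pdivrMr; last by lra.
move=> le3N; rewrite /e -[leLHS]mul1r ler_pdivrMr; last by lra.
by nra.
Unshelve. all: by end_near. Qed.

(** * Projections of the group elements *)

Lemma binary_icosahedral_unit (q : 'rV[R]_4) : binary_icosahedral R q -> unit_quats R q.
Proof.
rewrite binary_icosahedral_zvecs => -[l /= lI <-].
have sl := allP icosians_size4 _ lI; have /eqP := allP icosians_norm _ lI.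
rewrite /unit_quats /= /enorm => nl.
have -> : \sum_i zvec 2^-1 4 l 0 i ^+ 2 = 4^-1 * zval R (gnorm2 l).
  rewrite !big_ord_recl big_ord0 !mxE /=.
  case: l sl {lI nl} => [|w [|x [|y [|z []]]]] //= _.
  by rewrite !zvalD !zvalM zval0 !addr0; field.
by rewrite nl /zval /= mul0r addr0 mulVf// sqrtr1.
Qed.

Lemma quat1_zvec : quat1 R = zvec 2^-1 4 [:: g2; g0; g0; g0].
Proof.
rewrite -half_quat zval2 zval0; apply/rowP => i; rewrite !mxE.
by case: i => [[|[|[|[|//]]]] ?] /=; rewrite ?mulr0 ?mulVf.
Qed.

Lemma quatN1_zvec : - quat1 R = zvec 2^-1 4 [:: - g2; g0; g0; g0].
Proof. by rewrite quat1_zvec -zvec_opp//=. Qed.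

Lemma half_neq0 : 2^-1 != 0 :> R. Proof. by rewrite invr_eq0 pnatr_eq0. Qed.

Lemma icosians_no_pm1_size4 l : l \in icosians_no_pm1 -> size l = 4.
Proof. by rewrite mem_icosians_no_pm1 => /and3P[_ _ /(allP icosians_size4)/eqP]. Qed.

Lemma binary_icosahedral_no_pm1_zvecs :
  binary_icosahedral_no_pm1 R = zvecs 2^-1 4 icosians_no_pm1.
Proof.
rewrite /binary_icosahedral_no_pm1 binary_icosahedral_zvecs.
apply/seteqP; split=> [q [[l /= lI <-] lN]|_ [l /= + <-]].
  exists l => //=; rewrite mem_icosians_no_pm1 lI andbT.
  by apply/andP; split; apply/eqP => e; apply: lN;
    [left|right]; rewrite e ?quatN1_zvec ?quat1_zvec.
move=> lN; have sl := icosians_no_pm1_size4 lN.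
move: lN; rewrite mem_icosians_no_pm1 => /and3P[l1 lN1 lI]; split; first by exists l.
case; rewrite ?quatN1_zvec ?quat1_zvec => /(zvec_inj half_neq0 sl)/eqP.
  by rewrite (negPf l1) => /(_ erefl).
by rewrite (negPf lN1) => /(_ erefl).
Qed.

Lemma no_pm1_re_bounds q : binary_icosahedral_no_pm1 R q -> -1 < re_part q < 1.
Proof.
move=> [qI /not_orP[q1 qN1]]; apply: unit_re_bounds => //.
exact: binary_icosahedral_unit.
Qed.

Lemma re_part_zvec l : re_part (zvec 2^-1 4 l) = 2^-1 * zval R l`_0.
Proof. by rewrite /re_part mxE. Qed.

(** vertex_of multiplies the imaginary part of the doubled quaternion by phi^2
or phi^3, so c = 1 / (2 (1 + w) phi^k), which is positive because w > -1. *)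
Lemma stereo_vertex l : l \in icosians_no_pm1 ->
  exists2 c : R, 0 < c & stereo (zvec 2^-1 4 l) = c *: zvec 1 3 (vertex_of l).
Proof.
move=> lN; have qN : binary_icosahedral_no_pm1 R (zvec 2^-1 4 l).
  by rewrite binary_icosahedral_no_pm1_zvecs; exists l.
have /andP[reN1 _] := no_pm1_re_bounds qN.
have s0 : 0 < zval R (vertex_scale l`_0).
  rewrite /vertex_scale; case: ifP => _; rewrite ?zval_phi2 ?zval_phi3.
    by rewrite exprn_gt0// golden_gt0.
  by rewrite exprn_gt0// golden_gt0.
exists ((1 + re_part (zvec 2^-1 4 l))^-1 * 2^-1 / zval R (vertex_scale l`_0)).
  by rewrite divr_gt0// divr_gt0// invr_gt0; lra.
rewrite /stereo -!scalerA; congr (_ *: _); apply/rowP => i; rewrite !mxE mul1r.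
congr (_ * _); rewrite /vertex_of (nth_map 0) ?zvalM ?mulKf ?gt_eqF//.
  by rewrite nth_behead.
by rewrite size_behead icosians_no_pm1_size4.
Qed.

Lemma zvec_vertex_neq0 l : l \in all_vertices -> zvec (1 : R) 3 l != 0.
Proof.
move=> lV; have /eqP sl := allP vertices_size3 _ lV.
apply/eqP => l0; have e : zvec (1 : R) 3 l = zvec 1 3 [:: g0; g0; g0].
  rewrite l0; apply/rowP => i; rewrite !mxE.
  by case: i => [[|[|[|//]]] ?] /=; rewrite zval0 mulr0.
by have := vertices_neq0; rewrite -(zvec_inj (oner_neq0 _) sl _ e) ?lV.
Qed.

(** Equal directions mean m = c l with c > 0, so the minors of (l, m) vanish and
m = l or m = - l; in the second case (1 + c) l = 0 although l is nonzero. *)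
Lemma vertex_direction_inj l m : l \in all_vertices -> m \in all_vertices ->
  direction (zvec (1 : R) 3 l) = direction (zvec 1 3 m) -> l = m.
Proof.
move=> lV mV; have [l0 m0] := (zvec_vertex_neq0 lV, zvec_vertex_neq0 mV).
move=> /(direction_eq l0 m0)[c c0 mcl].
have /eqP sl := allP vertices_size3 _ lV.
have coord i : (i < 3)%N -> zval R m`_i = c * zval R l`_i.
  by move=> lt3; have /rowP/(_ (Ordinal lt3)) := mcl; rewrite !mxE !mul1r.
have := allP (allP vertices_collinear _ lV) _ mV.
move/implyP=> col; have : m \in [:: l; map -%R l].
  apply: col; rewrite /= andbT; apply/and3P; split; apply/eqP/(@zval_inj R);
    by rewrite !zvalM !coord//; ring.
rewrite !inE => /orP[/eqP->//|/eqP ml].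
move: mcl; rewrite ml zvec_opp// => /eqP; rewrite -subr_eq0 -opprD oppr_eq0.
rewrite -[X in X + _]scale1r -scalerDl scaler_eq0 (negPf l0) orbF.
by rewrite gt_eqF//; lra.
Qed.

End Geometry.

(** * The seven shells *)

Section Shells.
Variable R : realType.
Local Notation phi := (golden R).

Lemma vertex_ofP t l : t \in layers -> l \in layer t.1.1 ->
  vertex_of l \in vertices t.1.2.
Proof. by move=> tL lt; exact: (allP (allP layers_type t tL) l lt). Qed.

Lemma layer_icosians_no_pm1 t l : t \in layers -> l \in layer t.1.1 -> l \in icosians_no_pm1.
Proof. by move=> tL lt; exact: (allP (allP layers_icosians_no_pm1 t tL) l lt). Qed.

Lemma direction_stereo l : l \in icosians_no_pm1 ->
  direction (stereo (zvec 2^-1 4 l)) = direction (zvec (1 : R) 3 (vertex_of l)).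
Proof. by move=> /(stereo_vertex R)[c c0 ->]; rewrite directionZ. Qed.

Lemma layer_re w : [set q : 'rV[R]_4 | binary_icosahedral R q /\ re_part q = 2^-1 * zval R w]
  = zvecs 2^-1 4 (layer w).
Proof.
apply/seteqP; split=> [q []|_ [l /= + <-]].
  rewrite binary_icosahedral_zvecs => -[l /= lI <-].
  rewrite re_part_zvec => /(mulfI (half_neq0 R))/zval_inj lw.
  by exists l; rewrite //= mem_layer lw eqxx.
rewrite mem_layer => /andP[/eqP <- lI]; rewrite re_part_zvec; split=> //.
by rewrite binary_icosahedral_zvecs; exists l.
Qed.

Lemma no_pm1_radius (q : 'rV[R]_4) : binary_icosahedral_no_pm1 R q ->
  enorm (stereo q) = shell_radius (re_part q).
Proof.
move=> qN; have /andP[reN1 _] := no_pm1_re_bounds qN.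
by rewrite enorm_stereo//; case: qN => /binary_icosahedral_unit.
Qed.

Lemma layer_no_pm1 t l : t \in layers -> l \in layer t.1.1 ->
  binary_icosahedral_no_pm1 R (zvec 2^-1 4 l).
Proof.
move=> tL lt; rewrite binary_icosahedral_no_pm1_zvecs; exists l => //=.
exact: layer_icosians_no_pm1 lt.
Qed.

Lemma layer_bounds t : t \in layers -> -1 < 2^-1 * zval R t.1.1 < 1.
Proof.
move=> tL; have /hasP[l lt _] := allP layers_inhabited t tL.
have := no_pm1_re_bounds (layer_no_pm1 tL lt); rewrite re_part_zvec.
by move: lt; rewrite mem_layer => /andP[/eqP ->].
Qed.

(** The radius determines the real part, by injectivity of [shell_radius]. *)
Lemma shell_layer t : t \in layers ->
  shell (shell_radius (2^-1 * zval R t.1.1)) = zvecs 2^-1 4 (layer t.1.1).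
Proof.
move=> tL; apply/seteqP; split=> [q [qN]|_ [l /= lt <-]].
  rewrite no_pm1_radius// => /(shell_radius_inj (no_pm1_re_bounds qN) (layer_bounds tL)) re_q.
  by rewrite -layer_re; split=> //; case: qN.
have lN := layer_no_pm1 tL lt; split=> //; rewrite no_pm1_radius// re_part_zvec.
by move: lt; rewrite mem_layer => /andP[/eqP ->].
Qed.

(** Uniqueness of the type: the shell is inhabited, the direction of a vertex
determines the vertex, and no vertex has two types. *)
Lemma shell_layer_description t : t \in layers ->
  shell_description (shell_radius (2^-1 * zval R t.1.1)) t.1.2 t.2 (2^-1 * zval R t.1.1).
Proof.
move=> tL; split; last by rewrite shell_layer// layer_re.
- move=> T; split=> [typed|-> q].
    have /hasP[l lt _] := allP layers_inhabited t tL.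
    have lN := layer_icosians_no_pm1 tL lt.
    have [|v] := typed (zvec 2^-1 4 l); first by rewrite shell_layer//; exists l.
    rewrite M120p_of_type_zvecs direction_stereo// => -[m /= mT <-] dm.
    have := vertex_direction_inj (mem_vertices mT) (mem_vertices (vertex_ofP tL lt)) dm.
    by move=> em; apply: (vertices_type_inj mT); rewrite em; exact: vertex_ofP.
  rewrite shell_layer// => -[l /= lt <-].
  rewrite direction_stereo; last exact: layer_icosians_no_pm1 lt.
  exists (zvec 1 3 (vertex_of l)) => //; rewrite M120p_of_type_zvecs.
  by exists (vertex_of l) => //=; exact: vertex_ofP.
- rewrite shell_layer//; apply: card_zvecs (half_neq0 R) _ _ _.
  + exact/filter_uniq/uniq_icosians.
  + apply/allP => l; rewrite mem_layer => /andP[_ lI].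
    exact: (allP icosians_size4 l lI).
  + exact/eqP/(allP layers_size t tL).
Qed.

Lemma shell_radii : [set enorm (stereo q) | q in binary_icosahedral_no_pm1 R]
  = [set` [seq shell_radius (2^-1 * zval R t.1.1) | t <- layers]].
Proof.
apply/seteqP; split=> [_ [q qN <-]|r /mapP[t tL ->]].
  have := qN; rewrite binary_icosahedral_no_pm1_zvecs => -[l /= lN ql].
  have [t tL lt] := icosians_no_pm1_in_layer lN.
  rewrite no_pm1_radius// -ql re_part_zvec.
  move: lt; rewrite mem_layer => /andP[/eqP -> _].
  exact: (map_f (fun t => shell_radius (2^-1 * zval R t.1.1)) tL).
have /hasP[l lt _] := allP layers_inhabited t tL.
have lN := layer_no_pm1 tL lt; exists (zvec 2^-1 4 l) => //.
rewrite no_pm1_radius// re_part_zvec.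
by move: lt; rewrite mem_layer => /andP[/eqP ->].
Qed.

Lemma radius_phi : shell_radius (phi / 2) = 1 / Num.sqrt (4 * phi + 3).
Proof.
have p0 := golden_gt0 R; have p2 := golden_sqr R.
rewrite [RHS]div1r -sqrtrV; last by lra.
have a0 : 4 * phi + 3 != 0 by rewrite gt_eqF//; lra.
have b0 : 1 + phi / 2 != 0 by rewrite gt_eqF//; lra.
congr Num.sqrt; apply/eqP; rewrite -[eqbRHS]div1r eqr_div//; apply/eqP.
transitivity (3 + 5 / 2 * phi - 2 * phi ^+ 2); first by field.
by rewrite p2; field.
Qed.

Lemma radius_half : shell_radius (1 / 2) = 1 / Num.sqrt 3 :> R.
Proof.
by rewrite [RHS]div1r -sqrtrV ?ler0n//; congr Num.sqrt; field.
Qed.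

(** The squares are (2 phi - 1) / (2 phi + 1) and sqrt 5 / phi^3, with
sqrt 5 = 2 phi - 1 and phi^3 = 2 phi + 1. *)
Lemma radius_phiV :
  shell_radius (1 / (2 * phi)) = 5 `^ (1 / 4) / phi `^ (3 / 2).
Proof.
have p0 := golden_gt0 R; have p2 := golden_sqr R.
have b0 : 0 <= 5 `^ (1 / 4) / phi `^ (3 / 2) by rewrite divr_ge0 ?powR_ge0.
have powR_sqr (a x : R) : (a `^ x) ^+ 2 = a `^ (x * 2).
  by rewrite powRrM powR_mulrn ?powR_ge0.
rewrite -[RHS]ger0_norm// -sqrtr_sqr exprMn exprVn !powR_sqr.
rewrite (_ : 1 / 4 * 2 = 2^-1); last by field.
rewrite (_ : 3 / 2 * 2 = 3%:R); last by field.
rewrite powR12_sqrt ?powR_mulrn ?ltW// golden_cube.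
have -> : Num.sqrt 5 = 2 * phi - 1 by rewrite /golden; field.
by congr Num.sqrt; field; rewrite !gt_eqF//; lra.
Qed.

Lemma radius0 : shell_radius 0 = 1 :> R.
Proof. by rewrite /shell_radius subr0 addr0 divr1 sqrtr1. Qed.

End Shells.

Theorem mainTheorem2 (R : realType) :
  (* the numbers of vertices, of vertex directions and of group elements *)
  [/\ (M120p R #= `I_62)%card,
      ([set direction v | v in M120p R] #= `I_62)%card,
      (binary_icosahedral R #= `I_120)%card
    & (binary_icosahedral_no_pm1 R #= `I_118)%card] /\
  (* projections and vertices *)
  (forall q : 'rV[R]_4, binary_icosahedral_no_pm1 R q ->
     exists2 v, M120p R v & exists2 c : R, 0 < c & stereo q = c *: v) /\
  (forall v : 'rV[R]_3, M120p R v ->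
     exists2 q, binary_icosahedral_no_pm1 R q
              & direction (stereo q) = direction v) /\
  (* norms *)
  (forall q : 'rV[R]_4, binary_icosahedral_no_pm1 R q ->
     enorm (stereo q) = Num.sqrt ((1 - re_part q) / (1 + re_part q)) /\
     enorm (stereo q) * enorm (stereo (- q)) = 1) /\
  (* the origin and the point at infinity *)
  [/\ binary_icosahedral R (quat1 R), stereo (quat1 R) = 0,
      binary_icosahedral R (- quat1 R)
    & (Some (stereo q) : one_point_compactification 'rV[R]_3)
        @[q --> within (unit_quats R) ((- quat1 R)^')]
      --> (None : one_point_compactification 'rV[R]_3)] /\
  (* the seven shells *)
  let phi := golden R in
  let r1 := 1 / Num.sqrt (4 * phi + 3) in
  let r2 := 1 / Num.sqrt 3 in
  let r3 := 5 `^ (1 / 4) / phi `^ (3 / 2) in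
  let r4 := 1 in
  let r5 := phi `^ (3 / 2) / 5 `^ (1 / 4) in
  let r6 := Num.sqrt 3 in
  let r7 := Num.sqrt (4 * phi + 3) in
  [set enorm (stereo q) | q in binary_icosahedral_no_pm1 R]
    = [set` [:: r1; r2; r3; r4; r5; r6; r7]] /\
  [/\ shell_description r1 TypeC 12 (phi / 2),
      shell_description r2 TypeA 20 (1 / 2)
    & shell_description r3 TypeC 12 (1 / (2 * phi))] /\
  [/\ shell_description r4 TypeB 30 0,
      shell_description r5 TypeC 12 (- (1 / (2 * phi))),
      shell_description r6 TypeA 20 (- (1 / 2))
    & shell_description r7 TypeC 12 (- (phi / 2))].
Proof.
have p0 := golden_gt0 R.
have dir_inj : {in M120p R &, injective (@direction R 3)}.
  move=> u v; rewrite !inE M120p_zvecs => -[l /= lV <-] [m /= mV <-].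
  by move=> /(vertex_direction_inj lV mV) ->.
have cardV : (M120p R #= `I_62)%card.
  rewrite M120p_zvecs; apply: card_zvecs (oner_neq0 _) _ _ _.
  - exact: uniq_all_vertices.
  - exact: vertices_size3.
  - exact: size_all_vertices.
split; first split=> //.
- exact: card_eq_trans (inj_card_eq dir_inj) cardV.
- rewrite binary_icosahedral_zvecs; apply: card_zvecs (half_neq0 R) _ _ _.
  + exact: uniq_icosians.
  + exact: icosians_size4.
  + exact: size_icosians.
- rewrite binary_icosahedral_no_pm1_zvecs; apply: card_zvecs (half_neq0 R) _ _ _.
  + exact/filter_uniq/uniq_icosians.
  + by apply/allP => l /icosians_no_pm1_size4 ->.
  + exact: size_icosians_no_pm1.
split.
  move=> q; rewrite binary_icosahedral_no_pm1_zvecs => -[l /= lN <-].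
  have [t tL lt] := icosians_no_pm1_in_layer lN.
  have [c c0 ->] := stereo_vertex R lN.
  exists (zvec 1 3 (vertex_of l)); last by exists c.
  rewrite M120p_zvecs; exists (vertex_of l) => //.
  exact: (mem_vertices (vertex_ofP tL lt)).
split.
  move=> v; rewrite M120p_zvecs => -[m mV <-].
  have /mapP[l lN ->] := allP vertex_of_onto m mV.
  exists (zvec 2^-1 4 l); last exact: direction_stereo.
  by rewrite binary_icosahedral_no_pm1_zvecs; exists l.
split.
  move=> q qN; rewrite no_pm1_radius//; split=> //.
  have qb := no_pm1_re_bounds qN; have /andP[reN1 re1] := qb.
  have uq := binary_icosahedral_unit qN.1.
  rewrite enorm_stereo ?re_partN ?ltrN2//; last first.
    rewrite /unit_quats /= -uq /enorm; congr Num.sqrt.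
    by apply: eq_bigr => i _; rewrite mxE sqrrN.
  by rewrite shell_radiusN// mulfV// gt_eqF// shell_radius_gt0.
split.
  split; last exact: stereo_cvg_infty.
  - by left; left; exists (quat1 R); [rewrite !inE eqxx|left].
  - by rewrite /stereo vec_part1 scaler0.
  - by left; left; exists (quat1 R); [rewrite !inE eqxx|right].
move=> phi r1 r2 r3 r4 r5 r6 r7.
have describe w T n r v : (w, T, n) \in layers -> shell_radius v = r ->
    2^-1 * zval R w = v -> shell_description r T n v.
  by move=> tL <- <-; exact: (shell_layer_description R tL).
have w1 : 2^-1 * zval R gphi = phi / 2 by rewrite zval_phi mulrC.
have w2 : 2^-1 * zval R g1 = 1 / 2 by rewrite zval1 mulrC.
have w3 : 2^-1 * zval R gphiV = 1 / (2 * phi) by rewrite zval_phiV -/phi; field; rewrite gt_eqF.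
have w4 : 2^-1 * zval R g0 = 0 by rewrite zval0 mulr0.
have w5 : 2^-1 * zval R (- gphiV) = - (1 / (2 * phi)) by rewrite zvalN mulrN w3.
have w6 : 2^-1 * zval R (- g1) = - (1 / 2) by rewrite zvalN mulrN w2.
have w7 : 2^-1 * zval R (- gphi) = - (phi / 2) by rewrite zvalN mulrN w1.
have bounds w T n : (w, T, n) \in layers -> -1 < 2^-1 * zval R w < 1.
  by move=> /(layer_bounds R).
have s1 : shell_radius (phi / 2) = r1 by exact: radius_phi.
have s2 : shell_radius (1 / 2) = r2 by exact: radius_half.
have s3 : shell_radius (1 / (2 * phi)) = r3 by exact: radius_phiV.
have s4 : shell_radius 0 = r4 by exact: radius0.
have s5 : shell_radius (- (1 / (2 * phi))) = r5.
  by rewrite shell_radiusN -?w3 ?(bounds _ TypeC 12)// w3 s3 invf_div.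
have s6 : shell_radius (- (1 / 2)) = r6.
  by rewrite shell_radiusN -?w2 ?(bounds _ TypeA 20)// w2 s2 invf_div divr1.
have s7 : shell_radius (- (phi / 2)) = r7.
  by rewrite shell_radiusN -?w1 ?(bounds _ TypeC 12)// w1 s1 invf_div divr1.
split; first by rewrite shell_radii /= w1 w2 w3 w4 w5 w6 w7 s1 s2 s3 s4 s5 s6 s7.
split; split.
- exact: describe s1 w1.
- exact: describe s2 w2.
- exact: describe s3 w3.
- exact: describe s4 w4.
- exact: describe s5 w5.
- exact: describe s6 w6.
- exact: describe s7 w7.
Qed.
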